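(* There is an uncountable set of irrational $\alpha\in(0,1)$ such that for every $\alpha$ in this set and for every $x\in[0,1)$, $$\sum_{n\in V_{\alpha,x}}\frac1n<\infty .$$
   Context: Let $X=\mathbb{R}/\mathbb{Z}=[0,1)$, and let $\alpha\in(0,1)$ be irrational (always assumed). Let $I=[0,1/2]\subset X$ and $f(x)=\chi_I(x)-\chi_{X\setminus I}(x)$, so that $f=1$ on $I$ and $f=-1$ on $X\setminus I$. The cylinder flow is $T_\alpha:X\times\mathbb{Z}\to X\times\mathbb{Z}$, $T_\alpha(x,n)=(x+\alpha \bmod 1,\ n+f(x))$. Write $\pi_2(x,n)=n$ (the level), so $\pi_2(T_\alpha^n(x,0))=\sum_{i=0}^{n-1}f(x+i\alpha \bmod 1)$. The set of balanced times of $x$ is $V_{\alpha,x}=\{n\in\mathbb{Z}^+ : \pi_2(T_\alpha^n(x,0))=0\}$. A sum over an empty set is $0$. *)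

(* Defs.v *)
From HB Require Import structures.
From mathcomp Require Import all_boot all_order all_algebra.
From mathcomp Require Import all_classical all_reals all_analysis.
Set Implicit Arguments.
Unset Strict Implicit.
Unset Printing Implicit Defensive.
Import Order.TTheory GRing.Theory Num.Theory.
Local Open Scope classical_set_scope.
Local Open Scope ring_scope.

(* A point of R/Z is encoded by its representative in [0, 1[. *)
Definition circle (R : realType) : set R := [set` `[0, 1[].
Arguments circle : clear implicits.

Definition mod1 (R : realType) (x : R) : R := x - (Num.floor x)%:~R.

Definition half_circle (R : realType) : set R := [set` `[0, 2^-1]].
Arguments half_circle : clear implicits.

Definition step (R : realType) (x : R) : int :=
  \1_(half_circle R) x - \1_(circle R `\` half_circle R) x.

(* The flow is written on the ambient R * int; it maps circle R * int into
   itself, and only orbits starting there are meaningful. *)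
Definition cylinder_flow (R : realType) (alpha : R) (p : R * int) : R * int :=
  (mod1 (p.1 + alpha), p.2 + step p.1).

Definition balanced_times (R : realType) (alpha x : R) : set nat :=
  [set n | (0 < n)%N /\ (iter n (cylinder_flow alpha) (x, 0)).2 = 0].

(* Main.v *)
Require Import Defs.
From mathcomp Require Import all_boot all_order all_algebra.
From mathcomp Require Import all_classical all_reals all_analysis.
From mathcomp Require Import zify ring lra.
Set Implicit Arguments.
Unset Strict Implicit.
Unset Printing Implicit Defensive.
Import Order.TTheory GRing.Theory Num.Theory.
Local Open Scope classical_set_scope.
Local Open Scope ring_scope.

(** The rotation numbers are limits of fractions p_k / q_k with every q_k odd and
    q_(k+1) enormous compared with q_k, approached from below so closely that
    alpha - p_k / q_k <= 2 / (q_k q_(k+1)).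

    Why odd denominators.  Write alpha = p / q + delta with q odd.  The q points
    of an orbit segment of length q are nearly equidistributed, and a half circle
    contains either (q + 1) / 2 or (q - 1) / 2 of them: as long as no point drifts
    across an end of the half circle, the level changes by exactly +1 or -1 over
    the segment ([level_block]).  The sign is the parity of the integer part of
    2 q (x + n delta), a slowly growing quantity, so the level rises and falls in
    long zigzags.

    Up to time N = q_(k+1) this quantity grows by at most 4, so there are at most
    five monotone stretches.  A visit to a given level between m q and (m + 1) q
    forces the level at time m q to be within q of it, which leaves O(q) values of
    m in each stretch: every level is visited at most 30 q_k^2 times before time
    q_(k+1), from any starting point ([visits_le]).

    Summation over balanced times.  For q = q_k and r = q_(k-1), each time interval
    of length q contains at most 30 r^2 balanced times, and [0, q_(k+1)) contains
    at most 30 q^2 of them.  When q is large compared with r, cutting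
    [q_k, q_(k+1)) at a q and 2^k q^2 for a suitable a of order at most sqrt q
    bounds the sum of 1/n over the balanced times in [q_k, q_(k+1)) by
    90 / 2^k ([sum_inv_scale]), a convergent series.

    Uncountability.  Each denominator is chosen freely beyond a bound, hence for
    every sequence e of reals the fractions can be chosen so that the limit differs
    from every e_k ([exists_approximants_avoiding]).  Applied to an enumeration
    of all rationals together with a supposed enumeration of the admissible alpha,
    this yields an irrational admissible alpha outside the enumeration. *)

(** * Level of an orbit *)

(** The level reached after n steps from (x, 0); x is allowed to be any real, so
    that an orbit can be restarted at any time without reducing modulo 1. *)
Definition level (R : realType) (alpha x : R) (n : nat) : int :=
  \sum_(0 <= i < n) step (mod1 (x + i%:R * alpha)).

Lemma mod1_id (R : realType) (x : R) : circle R x -> mod1 x = x.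
Proof.
rewrite /circle /= in_itv /= => hx; rewrite /mod1.
have -> : Num.floor x = 0 by apply: floor_def; rewrite add0r.
by rewrite subr0.
Qed.

Lemma mod1D (R : realType) (x y : R) : mod1 (mod1 x + y) = mod1 (x + y).
Proof.
rewrite /mod1.
have -> : x - (Num.floor x)%:~R + y = x + y + (- Num.floor x)%:~R.
  by rewrite intrN; ring.
by rewrite floorDrz ?intr_int // intrKfloor intrD; ring.
Qed.

(** Off the two jumps, the step function is a parity: this turns every count of
    visits to the half circle into arithmetic modulo 2. *)
Lemma step_signr (R : realType) (z : R) (D : nat) :
  D%:R < 2 * z -> 2 * z < D.+1%:R -> step (mod1 z) = (-1) ^+ D.
Proof.
move=> lo hi.
have eD : D%:R = (odd D)%:R + 2 * (D./2)%:R :> R.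
  by rewrite -[in LHS](odd_double_half D) natrD -mul2n natrM.
have fz : Num.floor z = (D./2)%:Z.
  apply: floor_def; move: lo hi; rewrite -[D.+1]addn1 natrD eD intrD -pmulrn.
  by case: (odd D) => /= ? ?; apply/andP; split; lra.
rewrite -signr_odd /step /mod1 fz !indicE -pmulrn.
have -> : (z - (D./2)%:R \in half_circle R) = ~~ odd D.
  apply/idP/idP; rewrite inE /half_circle /= in_itv /=; move: lo hi;
    rewrite -[D.+1]addn1 natrD eD.
    by case: (odd D) => //= ? ? /andP[]; lra.
  by case: (odd D) => //= ? ? _; apply/andP; split; lra.
have -> : (z - (D./2)%:R \in circle R `\` half_circle R) = odd D.
  apply/idP/idP; rewrite inE /setD /half_circle /circle /= !in_itv /=;
    move: lo hi; rewrite -[D.+1]addn1 natrD eD.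
    by case: (odd D) => //= a b [_ []]; lra.
  case: (odd D) => //= a b _; split; first by apply/andP; split; lra.
  by apply/negP; rewrite negb_and -!ltNge; apply/orP; right; lra.
by case: (odd D).
Qed.

Lemma normr_step (R : realType) (z : R) : `|step z| <= 1 :> int.
Proof.
by rewrite /step !indicE; case: (_ \in _); case: (_ \in _).
Qed.

Lemma iter_cylinder_flow (R : realType) (alpha x : R) n : circle R x ->
  iter n (cylinder_flow alpha) (x, 0) = (mod1 (x + n%:R * alpha), level alpha x n).
Proof.
move=> cx; elim: n => [|n IH] /=.
  by rewrite mul0r addr0 mod1_id // /level big_geq.
rewrite IH /cylinder_flow /= mod1D /level big_nat_recr //=.
by congr (_, _); rewrite -[in RHS]natr1 mulrDl mul1r addrA.
Qed.

Lemma levelD (R : realType) (alpha x : R) m n :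
  level alpha x (m + n) = level alpha x m + level alpha (x + m%:R * alpha) n.
Proof.
rewrite /level (big_cat_nat _ (leq_addr n m)) //=; congr (_ + _).
rewrite -{1}[m]add0n big_addn addKn; apply: eq_bigr => i _.
by rewrite natrD mulrDl [_ * _ + _]addrC addrA.
Qed.

Lemma normr_level (R : realType) (alpha x : R) n : `|level alpha x n| <= n%:Z.
Proof.
rewrite /level; elim: n => [|n IH]; first by rewrite big_geq.
rewrite big_nat_recr //= -addn1 PoszD (le_trans (ler_normD _ _)) // lerD //.
exact: normr_step.
Qed.

(** * Orbits near a rational rotation with odd denominator *)

Lemma sum_signr_odd (n : nat) : \sum_(i < n) (-1) ^+ i = (odd n)%:R :> int.
Proof.
elim: n => [|n IH]; first by rewrite big_ord0.
by rewrite big_ord_recr /= IH -signr_odd; case: (odd n).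
Qed.

(** With c the integer part of 2 q (x + n delta), doubling the orbit point and
    multiplying by q lands in the unit interval above c + 2 n p, so the step is
    the parity of the quotient of c + 2 n p by q.  As q is odd, this quotient has
    the parity of c plus that of the remainder, and remainders are what an orbit
    segment permutes. *)
Lemma step_near_rational (R : realType) (p q c n : nat) (x delta : R) :
  odd q ->
  c%:R < 2 * q%:R * (x + n%:R * delta) < c.+1%:R ->
  step (mod1 (x + n%:R * (p%:R / q%:R + delta))) =
  (-1) ^+ (c + (c + n * (2 * p)) %% q).
Proof.
move=> oq /andP[lo hi]; have q0 : (0 < q)%N by case: q oq {lo hi}.
have qR : 0 < q%:R :> R by rewrite ltr0n.
set s := (c + n * (2 * p))%N; set D := (s %/ q)%N.
have Dlo : (D * q)%:R <= s%:R :> R by rewrite ler_nat leq_divM.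
have Dhi : s.+1%:R <= (D.+1 * q)%:R :> R by rewrite ler_nat ltn_ceil.
have sE : s%:R = c%:R + 2 * n%:R * p%:R :> R by rewrite natrD !natrM; ring.
set z := x + _.
have zE : 2 * z * q%:R = 2 * q%:R * (x + n%:R * delta) + 2 * n%:R * p%:R.
  by rewrite /z; field; rewrite gt_eqF.
rewrite (@step_signr _ _ D); last 2 first.
- rewrite -(ltr_pM2r qR) zE -[D%:R * _]natrM; lra.
- rewrite -(ltr_pM2r qR) zE -[D.+1%:R * _]natrM (lt_le_trans _ Dhi) //.
  rewrite -[s.+1]addn1 natrD sE.
  move: hi; rewrite -[c.+1]addn1 natrD; lra.
have sD : odd s = odd D (+) odd (s %% q).
  by rewrite {1}(divn_eq s q) oddD oddM oq andbT.
have cs : odd s = odd c by rewrite /s oddD !oddM /= andbF addbF.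
rewrite -signr_odd -[RHS]signr_odd oddD -cs sD.
by case: (odd D); case: (odd _).
Qed.

Lemma modn_affine_inj (q a b : nat) : coprime q a ->
  {in [pred i | (i < q)%N] &, injective (fun i => (b + i * a) %% q)%N}.
Proof.
move=> cqa.
have wlog_le i j : (i <= j)%N -> (j < q)%N ->
    ((b + i * a) %% q = (b + j * a) %% q)%N -> i = j.
  move=> ij jq /eqP; rewrite eq_sym eqn_mod_dvd ?leq_add2l ?leq_mul2r ?ij ?orbT //.
  rewrite subnDl -mulnBl Gauss_dvdl // => dv.
  have := leq_ltn_trans (leq_subr i j) jq.
  case: (posnP (j - i)) => [|h]; first by lia.
  by rewrite ltnNge (dvdn_leq h dv).
move=> i j; rewrite !inE => iq jq e.
by case: (leqP i j) => [ij|/ltnW ji]; [exact: wlog_le|apply/esym; exact: wlog_le].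
Qed.

(** Over q consecutive times the remainders of [step_near_rational] run through
    0, ..., q - 1 once each, and the alternating sum of q signs is 1 as q is odd. *)
Lemma level_block (R : realType) (p q c n : nat) (x delta : R) :
  odd q -> coprime p q -> 0 <= delta ->
  c%:R < 2 * q%:R * (x + n%:R * delta) ->
  2 * q%:R * (x + (n + q)%:R * delta) < c.+1%:R ->
  level (p%:R / q%:R + delta) x (n + q) =
  level (p%:R / q%:R + delta) x n + (-1) ^+ c.
Proof.
move=> oq cpq d0 lo hi; have q0 : (0 < q)%N by case: q oq {cpq lo hi}.
rewrite levelD; congr (_ + _); rewrite /level big_mkord.
pose sigma (i : 'I_q) : 'I_q :=
  Ordinal (ltn_pmod ((c + n * (2 * p)) + i * (2 * p)) q0).
have sigma_inj : injective sigma.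
  move=> i j /(congr1 val) /= e; apply/val_inj.
  apply: (modn_affine_inj _ _ _ e); rewrite ?inE ?ltn_ord //.
  by rewrite coprimeMr coprimen2 oq coprime_sym.
transitivity (\sum_(i < q) (-1) ^+ c * (-1) ^+ (sigma i) : int); last first.
  rewrite -mulr_sumr.
  rewrite -(reindex_inj sigma_inj (P := xpredT) (F := fun i : 'I_q => (-1) ^+ i)).
  by rewrite sum_signr_odd oq mulr1.
apply: eq_bigr => i _.
have -> : x + n%:R * (p%:R / q%:R + delta) + i%:R * (p%:R / q%:R + delta)
   = x + (n + i)%:R * (p%:R / q%:R + delta) by rewrite natrD; ring.
rewrite (@step_near_rational _ _ _ c) // ?exprD /= ?mulnDl ?addnA //.
have h1 : n%:R * delta <= (n + i)%:R * delta.
  by apply: ler_wpM2r => //; rewrite ler_nat leq_addr.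
have h2 : (n + i)%:R * delta <= (n + q)%:R * delta.
  by apply: ler_wpM2r => //; rewrite ler_nat leq_add2l ltnW.
have qR : 0 < 2 * q%:R :> R by rewrite mulr_gt0 // ltr0n.
apply/andP; split.
  by apply: (lt_le_trans lo); rewrite ler_pM2l // lerD2l.
by apply: le_lt_trans hi; rewrite ler_pM2l // lerD2l.
Qed.

Lemma level_run (R : realType) (p q c m d : nat) (x delta : R) :
  odd q -> coprime p q -> 0 <= delta ->
  c%:R < 2 * q%:R * (x + (m * q)%:R * delta) ->
  2 * q%:R * (x + ((m + d) * q)%:R * delta) < c.+1%:R ->
  level (p%:R / q%:R + delta) x ((m + d) * q) =
  level (p%:R / q%:R + delta) x (m * q) + d%:Z * (-1) ^+ c.
Proof.
move=> oq cpq d0 lo; have q0 : (0 < q)%N by case: q oq {cpq lo}.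
have qR : 0 < 2 * q%:R :> R by rewrite mulr_gt0 // ltr0n.
have mono k l : (k <= l)%N -> 2 * q%:R * (x + (k * q)%:R * delta) <=
    2 * q%:R * (x + (l * q)%:R * delta).
  move=> kl; rewrite ler_pM2l // lerD2l; apply: ler_wpM2r => //.
  by rewrite ler_nat leq_mul2r kl orbT.
elim: d => [|d IH] hi; first by rewrite addn0 mul0r addr0.
have hi' := le_lt_trans (mono (m + d)%N (m + d.+1)%N ltac:(lia)) hi.
have -> : ((m + d.+1) * q = (m + d) * q + q)%N by lia.
rewrite (@level_block _ p q c) ?IH //.
- by rewrite -addn1 PoszD; ring.
- by apply: (lt_le_trans lo); apply: mono; lia.
- by move: hi; rewrite addnS mulSn addnC.
Qed.

(** Cut time into blocks of length q and send a visit n = m q + i to: the integer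
    part of Y m = 2 q (x + m q delta), which takes at most 5 values; the level at
    time m q, which is within q of j; and i.  By [level_run], inside a class
    of m with the same integer part the level at block ends is strictly monotone,
    so these data determine n, except that a class may begin with an m for which
    Y m is itself an integer: there the block may meet the jump at 1/2, and one
    more boolean separates this m from the others.  The target has
    2 * 5 * (2 q + 1) * q <= 30 q^2 elements. *)
Lemma visits_le (R : realType) (p q N : nat) (x delta : R) (j : int) :
  odd q -> coprime p q -> 0 < delta -> 0 <= x ->
  2 * q%:R * (N%:R * delta) <= 4 ->
  (\sum_(0 <= n < N) (level (p%:R / q%:R + delta) x n == j) <= 30 * q ^ 2)%N.
Proof.
move=> oq cpq d0 x0 hN; have q0 : (0 < q)%N by case: q oq {cpq hN}.
have qR : 0 < 2 * q%:R :> R by rewrite mulr_gt0 // ltr0n.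
set alpha := _ + delta.
pose Y m := 2 * q%:R * (x + (m * q)%:R * delta).
have Y0 m : 0 <= Y m.
  by rewrite mulr_ge0 ?(ltW qR) // addr_ge0 // mulr_ge0 // ltW.
have Ylt k l : (k < l)%N -> Y k < Y l.
  by move=> kl; rewrite ltr_pM2l // ltrD2l ltr_pM2r // ltr_nat ltn_pmul2r.
have Yitv m := truncn_itv (Y0 m).
have Yclass n : (n < N)%N -> (Num.trunc (Y (n %/ q)%N) - Num.trunc (Y 0%N) < 5)%N.
  move=> nN.
  have : Y (n %/ q)%N <= Y 0%N + 4.
    rewrite /Y mul0n mul0r addr0 mulrDr lerD2l (le_trans _ hN) // ler_pM2l //.
    rewrite ler_pM2r // ler_nat; apply: leq_trans (ltnW nN); exact: leq_divM.
  move=> h; have /andP[lo _] := Yitv (n %/ q)%N; have /andP[_ hi] := Yitv 0%N.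
  have : (Num.trunc (Y (n %/ q)%N))%:R < ((Num.trunc (Y 0%N)).+1 + 4)%:R :> R.
    by rewrite natrD; lra.
  by rewrite ltr_nat; lia.
have Yclass0 m : (Num.trunc (Y 0%N) <= Num.trunc (Y m))%N.
  by apply: le_truncn; case: m => // m; apply/ltW/Ylt.
(* The level at time m q lies in [j - q, j + q]; adding q - j makes it a natural
   number below 2 q + 1. *)
pose phi (n : 'I_N) : bool * 'I_5 * 'I_(2 * q).+1 * 'I_q :=
  (Y (n %/ q)%N == (Num.trunc (Y (n %/ q)%N))%:R,
   inord (Num.trunc (Y (n %/ q)%N) - Num.trunc (Y 0%N)),
   inord (absz (level alpha x (n %/ q * q)%N - j + q%:Z)),
   Ordinal (ltn_pmod n q0)).
(* If the boolean is true at both ends, Y m = Y m' is the same integer, against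
   strict monotonicity; if false, Y m is interior to its class and [level_run]
   applies from m on. *)
have key m m' : (m < m')%N -> Num.trunc (Y m) = Num.trunc (Y m') ->
   (Y m == (Num.trunc (Y m))%:R) = (Y m' == (Num.trunc (Y m'))%:R) ->
   level alpha x (m * q) != level alpha x (m' * q).
  move=> mm' ec; rewrite -ec; have [em|nm] := eqVneq (Y m) _.
    by move/esym/eqP => em'; have := Ylt _ _ mm'; rewrite em em' ltxx.
  move=> _; have -> : m' = (m + (m' - m))%N by lia.
  rewrite (@level_run _ p q (Num.trunc (Y m))) // ?(ltW d0) //.
  - rewrite eq_sym -subr_eq0 [_ + _ * _]addrC addrK mulf_eq0 signr_eq0 orbF; lia.
  - by rewrite lt_neqAle eq_sym nm; case/andP: (Yitv m).
  - by rewrite subnKC ?(ltnW mm') // ec; case/andP: (Yitv m').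
have phi_inj : {in [pred n : 'I_N | level alpha x n == j] &, injective phi}.
  have bnd n : level alpha x n == j ->
     0 <= level alpha x (n %/ q * q)%N - j + q%:Z < (2 * q).+1%:Z.
    rewrite {1}(divn_eq n q) levelD => /eqP e.
    have := normr_level alpha (x + (n %/ q * q)%N%:R * alpha) (n %% q)%N.
    have := ltn_pmod n q0; lia.
  move=> n n'; rewrite !inE => /bnd bn /bnd bn' [ef ec el er].
  have ec' : Num.trunc (Y (n %/ q)%N) = Num.trunc (Y (n' %/ q)%N).
    move: ec => /(congr1 (@nat_of_ord _)); rewrite !inordK ?Yclass //.
    have := Yclass0 (n %/ q)%N; have := Yclass0 (n' %/ q)%N; lia.
  have el' : level alpha x (n %/ q * q)%N = level alpha x (n' %/ q * q)%N.
    move: el => /(congr1 (@nat_of_ord _)); rewrite !inordK //; lia.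
  apply/val_inj; rewrite /= (divn_eq n q) (divn_eq n' q) er; congr (_ * _ + _)%N.
  case: (ltngtP (n %/ q)%N (n' %/ q)%N) => // h.
    by have := key _ _ h ec' ef; rewrite el' eqxx.
  by have := key _ _ h (esym ec') (esym ef); rewrite el' eqxx.
have -> : (\sum_(0 <= n < N) (level alpha x n == j))%N =
          #|[pred n : 'I_N | level alpha x n == j]|.
  rewrite big_mkord -sum1_card [RHS]big_mkcond; apply: eq_bigr => i _.
  by rewrite inE; case: (_ == _).
apply: leq_trans (leq_card_in phi _ phi_inj) _.
by rewrite !card_prod card_bool !card_ord; nia.
Qed.

(** * Summing over balanced times *)

(** The constant 2 leaves room for all later fractions: consecutive ones differ by
    1 / (q_k q_(k+1)), and the tail of these gaps at most doubles the first one. *)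
Definition odd_approximants (R : realType) (alpha : R) (p q : nat -> nat) :=
  [/\ q 0%N = 1%N, forall k, odd (q k), forall k, coprime (p k) (q k),
      forall k, (16 ^ k.+1 * q k ^ 4 <= q k.+1)%N &
      forall k, (p k)%:R / (q k)%:R < alpha <=
                (p k)%:R / (q k)%:R + 2 / ((q k)%:R * (q k.+1)%:R)].

Lemma growth_ge2 (k q : nat) : (0 < q)%N -> (2 * q <= 16 ^ k.+1 * q ^ 4)%N.
Proof.
move=> q0; rewrite leq_mul //; last by rewrite -{1}[q]expn1 leq_pexp2l.
by apply: (@leq_trans (16 ^ 1)%N); rewrite ?leq_pexp2l.
Qed.

Lemma approximants_ltn (R : realType) (alpha : R) (p q : nat -> nat) :
  odd_approximants alpha p q -> forall k, (q k < q k.+1)%N.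
Proof.
case=> _ oq _ gr _ k; have q0 := odd_gt0 (oq k).
by apply: leq_trans (leq_trans (growth_ge2 k q0) (gr k)); lia.
Qed.

(** Every starting point is allowed in the hypothesis because the later intervals
    of length q restart the orbit elsewhere, at another level. *)
Lemma visits_mul (R : realType) (alpha x : R) (j : int) (q C m : nat) :
  0 <= alpha -> 0 <= x ->
  (forall (y : R) (i : int), 0 <= y ->
    (\sum_(0 <= n < q) (level alpha y n == i) <= C)%N) ->
  (\sum_(0 <= n < m * q) (level alpha x n == j) <= m * C)%N.
Proof.
move=> a0 x0 hC; elim: m => [|m IH]; first by rewrite mul0n big_geq.
rewrite mulSn addnC (big_cat_nat (n := m * q)) ?leq_addr //= [(m.+1 * C)%N]mulSnr leq_add //.
rewrite -{1}[(m * q)%N]add0n big_addn addKn.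
have y0 : 0 <= x + (m * q)%:R * alpha by rewrite addr_ge0 // mulr_ge0.
apply: leq_trans (hC _ (j - level alpha x (m * q)) y0).
apply: leq_sum => i _; rewrite addnC levelD addrC.
by rewrite -[in X in (_ <= X)%N](inj_eq (addIr (level alpha x (m * q)))) subrK.
Qed.

Lemma sum_inv_le (R : realType) (P : pred nat) (lo hi c : nat) :
  (0 < lo)%N -> (\sum_(0 <= n < hi) P n <= c)%N ->
  \sum_(lo <= n < hi | P n) (n%:R : R)^-1 <= c%:R / lo%:R.
Proof.
move=> lo0 hc; have [lohi|hilo] := leqP lo hi; last first.
  by rewrite big_geq ?divr_ge0 // ltnW.
have c1 : (\sum_(lo <= n < hi) P n)%:R <= c%:R :> R.
  by rewrite ler_nat (leq_trans _ hc) // [in leqRHS](big_cat_nat (n := lo)) //= leq_addl.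
apply: (@le_trans _ _ ((\sum_(lo <= n < hi) P n)%:R / lo%:R)); last first.
  by rewrite ler_pM2r // invr_gt0 ltr0n.
rewrite big_mkcond natr_sum mulr_suml; apply: ler_sum_nat => n /andP[ln _].
case: (P n); rewrite ?mul0r // mul1r lef_pV2 ?posrE ?ltr0n ?ler_nat //.
exact: leq_trans ln.
Qed.

(** The sum is cut at a q and at 2^k q^2, where a = 4^k r^2; each piece is bounded
    by the number of its terms times its largest term, that is by 30 a r^2 / q,
    30 2^k r^2 / a and 30 / 2^k respectively.  The value of a makes the second
    bound 30 / 2^k, and a^2 <= q makes the first one at most 30 r^2 / a. *)
Lemma sum_inv_scale (R : realType) (P : pred nat) (k r q Q : nat) :
  (0 < r)%N ->
  (forall m, \sum_(0 <= n < m * q) P n <= m * (30 * r ^ 2))%N ->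
  (\sum_(0 <= n < Q) P n <= 30 * q ^ 2)%N ->
  (16 ^ k * r ^ 4 <= q)%N -> (2 ^ k * q ^ 2 <= Q)%N ->
  \sum_(q <= n < Q | P n) (n%:R : R)^-1 <= 90 / 2 ^+ k.
Proof.
move=> r0 hP hQ rq qQ; set a := (4 ^ k * r ^ 2)%N.
have t0 : (0 < 2 ^ k)%N by rewrite expn_gt0.
have aq : (a * a <= q)%N.
  by rewrite /a mulnACA -expnMn -expnD.
have a0 : (0 < a)%N by rewrite muln_gt0 !expn_gt0 r0.
have q0 : (0 < q)%N by apply: leq_trans aq; rewrite muln_gt0 a0.
have alq : (a <= q)%N by apply: leq_trans aq; rewrite leq_pmulr.
have i2 : (a * q <= 2 ^ k * q ^ 2)%N.
  by rewrite -mulnn mulnA leq_mul2r; apply/orP; right; rewrite (leq_trans alq) // leq_pmull.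
rewrite (big_cat_nat (n := a * q)) ?leq_pmull ?(leq_trans i2) //=.
rewrite (big_cat_nat (n := 2 ^ k * q ^ 2) (p := Q)) //=.
have T : 0 < 2 ^+ k :> R by rewrite exprn_gt0.
have T1 : 1 <= 2 ^+ k :> R by rewrite exprn_ege1 // ler1n.
have rR : 0 < r%:R :> R by rewrite ltr0n.
have qR : 0 < q%:R :> R by rewrite ltr0n.
have aR : a%:R = 2 ^+ k * 2 ^+ k * r%:R ^+ 2 :> R.
  by rewrite /a natrM !natrX -exprMn -natrM.
have c2 (n : nat) : (30 * n ^ 2)%:R = 30 * n%:R ^+ 2 :> R.
  by rewrite natrM natrX.
have t2 (n : nat) : (2 ^ k * n)%:R = 2 ^+ k * n%:R :> R by rewrite natrM natrX.
clearbody a; have aRp : 0 < a%:R :> R by rewrite ltr0n.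
have e1 : \sum_(q <= n < a * q | P n) (n%:R : R)^-1 <= 30 / 2 ^+ k.
  apply: le_trans (sum_inv_le _ q0 (hP a)) _.
  rewrite ler_pdivrMr // mulrAC ler_pdivlMr //.
  have : a%:R * a%:R <= q%:R :> R by rewrite -natrM ler_nat.
  rewrite natrM c2 aR => h.
  have -> : 2 ^+ k * 2 ^+ k * r%:R ^+ 2 * (30 * r%:R ^+ 2) * 2 ^+ k =
     30 * (2 ^+ k * 2 ^+ k * r%:R ^+ 2 * (2 ^+ k * r%:R ^+ 2)) :> R by ring.
  rewrite ler_pM2l // (le_trans _ h) // ler_wpM2l //.
  by rewrite ler_pM2r ?exprn_gt0 // ler_peMl // ltW.
have e2 : \sum_(a * q <= n < 2 ^ k * q ^ 2 | P n) (n%:R : R)^-1 <= 30 / 2 ^+ k.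
  have := hP (2 ^ k * q)%N; rewrite -[(2 ^ k * q * q)%N]mulnA mulnn => h.
  apply: le_trans (sum_inv_le _ _ h) _; first by rewrite muln_gt0 a0.
  rewrite natrM t2 c2 natrM aR le_eqVlt; apply/orP; left; apply/eqP; field.
  by rewrite !gt_eqF.
have e3 : \sum_(2 ^ k * q ^ 2 <= n < Q | P n) (n%:R : R)^-1 <= 30 / 2 ^+ k.
  apply: le_trans (sum_inv_le _ _ hQ) _; first by rewrite muln_gt0 t0 expn_gt0 q0.
  rewrite c2 t2 natrX le_eqVlt; apply/orP; left; apply/eqP; field.
  by rewrite !gt_eqF.
lra.
Qed.

(** The horizon q_(k+1) is matched to the quality of the approximation: the drift
    2 q_k (q_(k+1) delta) is at most 4. *)
Lemma approximant_visits (R : realType) (alpha y : R) (p q : nat -> nat)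
    (k : nat) (j : int) :
  odd_approximants alpha p q -> 0 <= y ->
  (\sum_(0 <= n < q k.+1) (level alpha y n == j) <= 30 * q k ^ 2)%N.
Proof.
case=> _ oq cpq _ app y0; have /andP[lo hi] := app k.
have qp i : 0 < (q i)%:R :> R by rewrite ltr0n odd_gt0.
have -> : alpha = (p k)%:R / (q k)%:R + (alpha - (p k)%:R / (q k)%:R).
  by rewrite addrC subrK.
apply: visits_le => //; first by rewrite subr_gt0.
have : alpha - (p k)%:R / (q k)%:R <= 2 / ((q k)%:R * (q k.+1)%:R) by rewrite lerBlDl.
move=> d; have -> : 4 = 2 * (q k)%:R * ((q k.+1)%:R * (2 / ((q k)%:R * (q k.+1)%:R))) :> R.
  by field; rewrite !gt_eqF.
by rewrite -!mulrA ler_pM2l // !ler_pM2l.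
Qed.

(** The sum starts at q_1 because the bound on [q_k, q_(k+1)) uses the scale
    q_(k-1) as well; 90 (1 - 2^-k) is the sum of 90 / 2^i for 1 <= i <= k. *)
Lemma approximants_sum_le (R : realType) (alpha x : R) (p q : nat -> nat)
    (k : nat) :
  odd_approximants alpha p q -> 0 <= x ->
  \sum_(q 1%N <= n < q k.+1 | level alpha x n == 0) (n%:R : R)^-1 <=
  90 * (1 - 2 ^- k).
Proof.
move=> h x0; have qlt := approximants_ltn h; case: (h) => q0 oq cpq gr app.
have qp i : (0 < q i)%N by rewrite odd_gt0.
have a0 : 0 <= alpha.
  have /andP[/ltW lo _] := app 0%N; apply: le_trans lo; exact: divr_ge0.
have q1le i : (q 1%N <= q i.+1)%N.
  by elim: i => // i IH; exact: leq_trans IH (ltnW (qlt _)).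
elim: k => [|k IH]; first by rewrite big_geq // expr0 invr1 subrr mulr0.
rewrite (big_cat_nat (n := q k.+1)) ?(ltnW (qlt _)) //=.
have hv m : (\sum_(0 <= n < m * q k.+1) (level alpha x n == 0) <=
             m * (30 * q k ^ 2))%N.
  by apply: visits_mul => // y j; exact: approximant_visits h.
have sq : (2 ^ k.+1 * q k.+1 ^ 2 <= q k.+2)%N.
  apply: leq_trans (gr k.+1); rewrite leq_mul //; last by rewrite leq_pexp2l.
  by apply: leq_trans (_ : 16 ^ k.+1 <= _)%N; rewrite ?leq_exp2r ?leq_pexp2l.
have H := @sum_inv_scale R [pred n | level alpha x n == 0] k.+1 (q k)
  (q k.+1) (q k.+2) (qp k) hv (approximant_visits k.+1 0 h x0) (gr k) sq.
apply: le_trans (lerD IH H) _; rewrite exprS invfM.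
have T : 0 < 2 ^- k :> R by rewrite invr_gt0 exprn_gt0.
lra.
Qed.

Lemma approximants_esum (R : realType) (alpha x : R) (p q : nat -> nat) :
  odd_approximants alpha p q -> circle R x ->
  (\esum_(n in balanced_times alpha x) ((n%:R : R)^-1)%:E < +oo)%E.
Proof.
move=> h cx; have qlt := approximants_ltn h; case: (h) => q0 oq _ _ _.
have x0 : 0 <= x by move: cx; rewrite /circle /= in_itv /= => /andP[].
have qp i : (0 < q i)%N by rewrite odd_gt0.
have kq k : (k < q k)%N by elim: k => // k IH; exact: leq_ltn_trans IH (qlt k).
have q1le k : (q 1%N <= q k.+1)%N.
  by elim: k => // k IH; exact: leq_trans IH (ltnW (qlt _)).
pose P := [pred n : nat | (0 < n)%N && (level alpha x n == 0)].
have -> : balanced_times alpha x = [set n | P n].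
  apply/seteqP; split => n; rewrite /balanced_times /= iter_cylinder_flow //=.
    by move=> [-> ->]; rewrite eqxx.
  by move=> /andP[-> /eqP].
rewrite -nneseries_esum; last by move=> n _; rewrite lee_fin invr_ge0.
set C : R := \sum_(1 <= n < q 1%N | P n) n%:R^-1 + 90.
apply: (@le_lt_trans _ _ C%:E); last exact: ltry.
apply: lime_le; first by apply: is_cvg_nneseries => n _ _; rewrite lee_fin invr_ge0.
apply: nearW => N; rewrite sumEFin lee_fin.
apply: (@le_trans _ _ (\sum_(0 <= n < q N.+1 | P n) n%:R^-1)).
  rewrite (big_cat_nat (n := N) (p := q N.+1)) //=; last exact: ltnW (ltnW (kq N.+1)).
  by rewrite lerDl sumr_ge0 // => n _; rewrite invr_ge0.
rewrite (big_cat_nat (n := 1)) //= (big_cat_nat (n := q 1%N) (p := q N.+1)) //=.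
rewrite big_mkcond big_nat1 /= add0r lerD2l.
apply: le_trans (_ : 90 * (1 - 2 ^- N) <= _); last first.
  have : 0 < 2 ^- N :> R by rewrite invr_gt0 exprn_gt0.
  lra.
rewrite (le_trans _ (approximants_sum_le N h x0)) // le_eqVlt; apply/orP; left; apply/eqP.
rewrite big_nat_cond [RHS]big_nat_cond; apply: eq_bigl => n.
case: (ltnP 0 n) => //= n0.
by rewrite [(q 1 <= n)%N]leqNgt (leq_ltn_trans n0) ?qp.
Qed.

(** * Construction of rotation numbers *)

(** Bezout gives one solution (u, v); adding multiples of (p, q) to it makes the
    denominator large, and, q being odd, one more (p, q) corrects its parity. *)
Lemma next_fraction (p q B : nat) : coprime p q -> odd q ->
  exists s : nat * nat,
    [/\ s.1 * q = p * s.2 + 1, coprime s.1 s.2, odd s.2 & B <= s.2]%N.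
Proof.
move=> cpq oq; have q0 := odd_gt0 oq.
have /(coprimeP _ q0)[[u v] /= uv] : coprime q p by rewrite coprime_sym.
have e t : ((u + t * p) * q = p * (v + t * q) + 1)%N by nia.
pose t := (B + (odd (v + B * q) == false))%N.
exists ((u + t * p), (v + t * q))%N; split => /=.
- exact: e.
- set a := (u + _)%N; set b := (v + _)%N.
  rewrite /coprime -dvdn1 -(dvdn_addr (m := p * b) 1).
    by rewrite -e dvdn_mulr // dvdn_gcdl.
  by rewrite dvdn_mull // dvdn_gcdr.
- rewrite /t; have [ob|ob] := boolP (odd (v + B * q)) => /=; rewrite ?addn0 //.
  by rewrite mulnDl mul1n addnA oddD (negbTE ob) oq.
- by rewrite /t; nia.
Qed.

(** The limit lies strictly above every fraction p_k / q_k and at most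
    2 / (q_k q_(k+1)) above it.  To avoid e_k, nothing is needed when
    e_k <= p_k / q_k; otherwise q_(k+1) is taken so large that e_k lies beyond
    this range.  Consecutive fractions have determinant 1, so their difference is
    w_k = 1 / (q_k q_(k+1)), and since w_(k+1) <= w_k / 2 the intervals
    [p_k / q_k, p_k / q_k + 2 w_k] are nested. *)
Lemma exists_approximants_avoiding (R : realType) (e : nat -> R) :
  exists alpha : R, [/\ 0 < alpha < 1, exists p q, odd_approximants alpha p q
    & forall k, alpha != e k].
Proof.
pose r (s : nat * nat) : R := s.1%:R / s.2%:R.
have step_ex (ks : nat * (nat * nat)) : exists s' : nat * nat,
    let: (k, s) := ks in coprime s.1 s.2 -> odd s.2 ->
    [/\ (s'.1 * s.2 = s.1 * s'.2 + 1)%N, coprime s'.1 s'.2, odd s'.2,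
        (16 ^ k.+1 * s.2 ^ 4 <= s'.2)%N &
        r s < e k -> r s + 2 / (s.2%:R * s'.2%:R) < e k].
  case: ks => k s; case: (boolP (coprime s.1 s.2 && odd s.2)); last first.
    by move=> ns; exists s => c o; case/negP: ns; rewrite c o.
  move=> /andP[c o].
  have [s' [e1 c' o' B]] := next_fraction
    (16 ^ k.+1 * s.2 ^ 4 + Num.bound (2 / (e k - r s))) c o.
  exists s' => _ _; split => //; first exact: leq_trans (leq_addr _ _) B.
  move=> lt_re; rewrite -ltrBrDl; set d := e k - r s.
  have d0 : 0 < d by rewrite subr_gt0.
  have s1 : 1 <= s.2%:R :> R by rewrite ler1n odd_gt0.
  have s'0 : 0 < s'.2%:R :> R by rewrite ltr0n odd_gt0.
  have hb : 2 / d < s'.2%:R.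
    apply: lt_le_trans (archi_boundP _) _; first by rewrite divr_ge0 // ltW.
    by rewrite ler_nat (leq_trans _ B) // leq_addl.
  rewrite ltr_pdivrMr in hb => //.
  rewrite ltr_pdivrMr ?mulr_gt0 ?(lt_le_trans _ s1) //.
  apply: lt_le_trans hb _; rewrite mulrC ler_pM2l // ler_peMl // ltW.
have [F hF] := choice step_ex.
have [s [s0 sS]] : exists s : nat -> nat * nat,
    s 0%N = (0, 1)%N /\ forall k, s k.+1 = F (k, s k).
  by exists (nat_rect (fun _ => nat * nat)%type (0, 1)%N (fun k s => F (k, s))).
have inv k : coprime (s k).1 (s k).2 /\ odd (s k).2.
  elim: k => [|k [c o]]; first by rewrite s0.
  by rewrite sS; have [] := hF (k, s k) c o.
have hs k := let: conj c o := inv k in hF (k, s k) c o.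
have {}hs k : [/\ ((s k.+1).1 * (s k).2 = (s k).1 * (s k.+1).2 + 1)%N,
    (16 ^ k.+1 * (s k).2 ^ 4 <= (s k.+1).2)%N &
    r (s k) < e k -> r (s k) + 2 / ((s k).2%:R * (s k.+1).2%:R) < e k].
  by rewrite sS; have [? _ _] := hs k.
have q0 k : (0 < (s k).2)%N by case: (inv k) => _ /odd_gt0.
have qR k : 0 < (s k).2%:R :> R by rewrite ltr0n.
pose w k : R := ((s k).2%:R * (s k.+1).2%:R)^-1.
have w0 k : 0 < w k by rewrite invr_gt0 mulr_gt0.
have rS k : r (s k.+1) = r (s k) + w k.
  have [/(congr1 (fun n => n%:R : R)) e1 _ _] := hs k.
  rewrite natrD !natrM in e1.
  rewrite /r /w.
  apply: (mulIf (x := (s k).2%:R * (s k.+1).2%:R)); first by rewrite gt_eqF ?mulr_gt0.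
  rewrite mulrDl mulVf ?gt_eqF ?mulr_gt0 //.
  have -> : (s k.+1).1%:R / (s k.+1).2%:R * ((s k).2%:R * (s k.+1).2%:R) =
     (s k.+1).1%:R * (s k).2%:R :> R.
    by field; rewrite gt_eqF //; exact: qR.
  by rewrite e1; congr (_ + _); field; rewrite gt_eqF //; exact: qR.
have w2 k : 2 * w k.+1 <= w k.
  have [_ g1 _] := hs k; have [_ g2 _] := hs k.+1.
  have g : (2 * (s k).2 <= (s k.+2).2)%N.
    have := growth_ge2 k (q0 k); have := growth_ge2 k.+1 (q0 k.+1); lia.
  rewrite /w ler_pdivrMr ?mulr_gt0 // mulrC ler_pdivlMr ?mulr_gt0 //.
  have : 2 * (s k).2%:R <= (s k.+2).2%:R :> R by rewrite -natrM ler_nat.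
  by move=> h; rewrite mulrA [leRHS]mulrC ler_pM2r.
pose E := range (r \o s).
have rmono k l : (k <= l)%N -> r (s k) <= r (s l).
  apply: (@homo_leq _ (r \o s) <=%R) => //; first exact: le_trans.
  by move=> i /=; rewrite rS lerDl ltW.
have umono k l : (k <= l)%N -> r (s l) + 2 * w l <= r (s k) + 2 * w k.
  apply: (@homo_leq _ (fun l => r (s l) + 2 * w l) (fun a b => b <= a)) => //.
    by move=> a b c /= ba cb; exact: le_trans cb ba.
  by move=> i; rewrite rS; have := w2 i; lra.
have Eub k : ubound E (r (s k) + 2 * w k).
  move=> _ [l _ <-] /=; have [kl|/ltnW lk] := leqP k l.
    by apply: le_trans (umono _ _ kl); rewrite lerDl mulr_ge0 // ltW.
  by apply: le_trans (rmono _ _ lk) _; rewrite lerDl mulr_ge0 // ltW.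
have lo k : r (s k) < sup E.
  apply: (@lt_le_trans _ _ (r (s k.+1))); first by rewrite rS ltrDl.
  by apply: ub_le_sup; [exists (r (s 0%N) + 2 * w 0%N); exact: Eub|exists k.+1].
have hi k : sup E <= r (s k) + 2 * w k.
  by apply: ge_sup; [exists (r (s 0%N)), 0%N|exact: Eub].
(* With q_0 = 1 and q_1 >= 16 the interval for k = 0 lies in [0, 1/8]. *)
exists (sup E); split.
- apply/andP; split; first by apply: le_lt_trans (lo 0%N); rewrite /r s0 mul0r.
  apply: le_lt_trans (hi 0%N) _; rewrite /r s0 /= mul0r add0r.
  have [_ g1 _] := hs 0%N; rewrite s0 expn1 exp1n muln1 in g1.
  rewrite /w s0 mul1r ltr_pdivrMr // mul1r ltr_nat; exact: leq_trans g1.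
- exists (fun k => (s k).1), (fun k => (s k).2); split => //; first by rewrite s0.
  + by move=> k; case: (inv k).
  + by move=> k; case: (inv k).
  + by move=> k; case: (hs k).
  + by move=> k; rewrite lo hi.
- move=> k; have [_ _ g] := hs k; apply/eqP => ek.
  have := hi k; rewrite leNgt ek g // -ek; exact: lo.
Qed.

Theorem theorem2 (R : realType) :
  exists A : set R,
    [/\ A `<=` `]0, 1[ `&` @irrational R,
        ~ countable A &
        forall alpha x : R, A alpha -> circle R x ->
          (\esum_(n in balanced_times alpha x) ((n%:R : R)^-1)%:E < +oo)%E].
Proof.
pose A := [set alpha : R | [/\ 0 < alpha < 1, irrational alpha &
   exists p q, odd_approximants alpha p q]].
exists A; split.
- by move=> alpha [a01 irr _]; split => //=; rewrite in_itv.
- move=> cA.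
  have cB : countable (A `|` @rational R).
    rewrite -bigcup2E; apply: bigcup_countable => // -[|[|n]] _ //=.
    by apply: sub_countable (card_image_le _ _) _; exact: countableP.
  move/countable_injP: cB => [f f_inj].
  (* e is a left inverse of f on the union: an enumeration of it. *)
  pose e k := xget 0 [set a | (A `|` @rational R) a /\ f a = k].
  have [alpha [a01 app av]] := exists_approximants_avoiding e.
  have : (A `|` @rational R) alpha.
    have [rat|irr] := pselect (@rational R alpha); [by right|by left; split].
  move=> Ba; have [Be fe] : [set a | (A `|` @rational R) a /\ f a = f alpha] (e (f alpha)).
    by apply: xgetPex; exists alpha.
  by have /eqP := av (f alpha); apply; apply: f_inj; rewrite ?inE.
- by move=> alpha x [_ _ [p [q h]]]; exact: approximants_esum h.
Qed.
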